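(* Let $n\ge2$, let $m\in\mathbb N^n$, and let $P=(P_1,\ldots,P_n)$ be a positive regular polynomial $n$-tuple such that for some $i\in\{1,\ldots,n-1\}$, $$\partial_nP_i=0\quad\text{and}\quad\partial_iP_j=0\ \text{ for all }1\le j\le n,\ j\ne i.$$ Then the multiplication operator $\mathscr M_{z_n}$ on $\mathscr H^2_m(\triangle^n_P)$ is not essentially normal.
   Context: $\mathbb N$ = positive integers, $\mathbb C_*=\mathbb C\setminus\{0\}$, $z\diamond w=(z_1w_1,\ldots,z_nw_n)$, and $\overline z$ is the entrywise conjugate. For $n\ge2$ let $\varphi(z)=\big(\frac{z_1}{z_2},\ldots,\frac{z_{n-1}}{z_n},z_n\big)$ for $z\in\mathbb C\times\mathbb C_*^{n-1}$. A polynomial $n$-tuple $P=(P_1,\ldots,P_n)$ in $\mathbb C[z_1,\ldots,z_n]$ is positive regular if for each $j$, $P_j$ has nonnegative coefficients and $P_j(z)=a_jz_j+\sum_{k=2}^{N_j}Q_{jk}(z)$ with $a_j>0$ and $Q_{jk}$ homogeneous of degree $k$. The $P$-triangle is $\triangle^n_P=\{z\in\mathbb C\times\mathbb C_*^{n-1}: P_j(\varphi(z)\diamond\overline{\varphi(z)})<1,\ j=1,\ldots,n\}$. For $m\in\mathbb N^n$, $\mathscr H^2_m(\triangle^n_P)$ is the reproducing kernel Hilbert space of holomorphic functions on $\triangle^n_P$ with kernel $$\mathscr K_{P,m}(z,w)=\prod_{j=2}^n\frac1{z_j\overline w_j}\prod_{j=1}^n\frac1{\big(1-P_j(\varphi(z)\diamond\overline{\varphi(w)})\big)^{m_j}}.$$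 Each $z_j$ is a multiplier of this space, and $\mathscr M_{z_j}$ is the bounded operator of multiplication by $z_j$. A bounded operator $T$ is essentially normal if $T^*T-TT^*$ is compact. $\partial_k$ is the partial derivative in $z_k$; $\partial_kP_j=0$ means it vanishes identically. *)

(* Defs.v *)
From HB Require Import structures.
From mathcomp Require Import all_boot all_order all_algebra.
(* mpoly has to be imported before mathcomp-analysis: in the other order their
   notations clash. *)
From mathcomp Require Import mpoly complex.
From mathcomp Require Import all_classical all_reals all_analysis.

Set Implicit Arguments.
Unset Strict Implicit.
Unset Printing Implicit Defensive.

Import Order.TTheory GRing.Theory Num.Theory.
Import numFieldNormedType.Exports.

Local Open Scope classical_set_scope.
Local Open Scope ring_scope.

(* The usual topology and norm of C: mathcomp-analysis only equips abstract
   numeric fields with them. *)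
HB.instance Definition _ (R : realType) := NormedModule.copy R[i] R[i]^o.

(* Coordinates are numbered from 0, in dimension n.+1: the coordinates
   z_1, ..., z_n of the mathematical text in C^n are z 0 ord0, ...,
   z 0 ord_max in 'rV[R[i]]_n.+1, with n here one less than there.
   The order on R[i] is partial: [x < 1] and [0 <= x] force x to be real. *)

Section Triangle.
Context {R : realType} {n : nat}.
Local Notation C := R[i].
Implicit Types z w : 'rV[C]_n.+1.
Implicit Types P : 'I_n.+1 -> {mpoly C[n.+1]}.

Definition diamond z w : 'rV[C]_n.+1 := \row_j (z 0 j * w 0 j).

Definition phi z : 'rV[C]_n.+1 :=
  \row_(j < n.+1)
    (if (j < n)%N then z 0 j / z 0 (inord j.+1) else z 0 j).

Definition CxCstar : set 'rV[C]_n.+1 :=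
  [set z | forall j, j != ord0 -> z 0 j != 0].

Definition positive_regular P : Prop :=
  forall j,
    (forall s : 'X_{1..n.+1}, 0 <= (P j)@_s) /\
    exists (a : C) (N : nat) (Q : nat -> {mpoly C[n.+1]}),
      [/\ 0 < a,
          forall k, Q k \is k.-homog
        & P j = a *: 'X_j + \sum_(2 <= k < N.+1) Q k].

Definition Peval P (j : 'I_n.+1) z w : C :=
  (P j).@[diamond (phi z) (map_mx Num.conj (phi w)) 0].

Definition triangle P : set 'rV[C]_n.+1 :=
  [set z | CxCstar z /\ forall j, Peval P j z z < 1].

Definition kernel P (m : 'I_n.+1 -> nat) z w : C :=
  (\prod_(j < n.+1 | j != ord0) (z 0 j * Num.conj (w 0 j))^-1) *
  \prod_(j < n.+1) ((1 - Peval P j z w) ^+ m j)^-1.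

(* Fréchet differentiability over the complex field. A function on D is
   represented on the subtype of D; when D is open, the choice of the extension
   F does not matter. *)
Definition holomorphic (D : set 'rV[C]_n.+1) (f : D -> C) : Prop :=
  exists F : 'rV[C]_n.+1 -> C,
    (forall z : D, f z = F (val z)) /\
    (forall z, D z -> differentiable F z).

End Triangle.

Record hilbertSpace (R : realType) := HilbertSpace {
  hilbert_sort :> completeNormedModType R[i];
  (* linear in the first argument, conjugate-linear in the second *)
  inner : {dot hilbert_sort for (@Num.conj R[i])};
  inner_norm : forall f : hilbert_sort, inner f f = `|f| ^+ 2
}.

Section Operators.
Context {R : realType} {H : hilbertSpace R}.

Definition bounded_operator (T : {linear H -> H}) : Prop :=
  exists M : R[i], forall f : H, `|T f| <= M * `|f|.

Definition adjoint (T S : H -> H) : Prop :=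
  forall f g : H, inner H (T f) g = inner H f (S g).

Definition compact_operator (T : H -> H) : Prop :=
  compact (closure (T @` [set f : H | `|f| <= 1])).

Definition essentially_normal (T : H -> H) : Prop :=
  exists2 S : H -> H, adjoint T S &
    compact_operator (fun f => S (T f) - T (S f)).

End Operators.

(* A Hilbert space of functions X -> C, its elements being identified with
   functions through the injective linear map rkhs_fun. *)
Record rkhs (R : realType) (X : Type) (K : X -> X -> R[i]) := RKHS {
  rkhs_space :> hilbertSpace R;
  rkhs_fun : {linear rkhs_space -> (X -> R[i])};
  rkhs_fun_inj : injective rkhs_fun;
  rkhs_reproducing : forall w : X,
    exists2 k : rkhs_space, rkhs_fun k = (fun z => K z w) &
      forall f : rkhs_space, rkhs_fun f w = inner rkhs_space f k
}.

(* By the Moore-Aronszajn theorem, this structure is unique up to a unitary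
   isomorphism which preserves the underlying functions. *)
Record H2 (R : realType) (n : nat) (P : 'I_n.+1 -> {mpoly R[i][n.+1]})
    (m : 'I_n.+1 -> nat) := MkH2 {
  H2_rkhs :> rkhs (fun z w : triangle P => kernel P m (val z) (val w));
  H2_holomorphic : forall f : H2_rkhs, holomorphic (rkhs_fun H2_rkhs f)
}.

Definition is_mulz (R : realType) (n : nat) (P : 'I_n.+1 -> {mpoly R[i][n.+1]})
    (m : 'I_n.+1 -> nat) (H : H2 P m) (j : 'I_n.+1) (T : H -> H) : Prop :=
  forall (f : H) (z : triangle P), rkhs_fun H (T f) z = val z 0 j * rkhs_fun H f z.

(* Main.v *)
(* The kernel functions at points with real coordinates suffice. In the
   coordinates u = phi(z), let u_i = x and u_n = y vary and freeze the others at
   a small c > 0: as P_i does not involve u_n and the other P_j do not involve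
   u_i, the kernel, stripped of its prefactor, becomes a product
   F(x, x') G(y, y'). Since S k_w = conj(w_n) k_w for the adjoint S of
   T = M_{z_n}, Cauchy-Schwarz applied to <T v, v - v'>, with v, v' the kernel
   functions at (x, c) and (x, -c), gives <(ST - TS) v, v> >= 5/4 c^2 |v|^2,
   uniformly in x. When x tends to the boundary, F(x, x) tends to infinity, so
   the normalized vectors v become nearly orthogonal to one another, which is
   impossible if ST - TS is compact. *)
Require Import Defs.
From mathcomp Require Import all_boot all_order all_algebra.
From mathcomp Require Import mpoly complex.
From mathcomp Require Import all_classical all_reals all_analysis.
From mathcomp Require Import ring lra.
Import Order.TTheory GRing.Theory Num.Theory.
Import numFieldNormedType.Exports.
Local Open Scope ring_scope.

(** * Real inner product and compactness *)

Section RealInner.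
Local Open Scope classical_set_scope.
Context {R : realType} {H : hilbertSpace R}.
Implicit Types f g h : H.

(** Real parts suffice because all kernel values and scalars in use are real; inequalities then live
    in the ordered field [R]. *)
Definition rip f g : R := complex.Re (inner H f g).

Lemma ripC f g : rip f g = rip g f.
Proof. by rewrite /rip hermC /= expr0 mul1r; case: (inner H g f). Qed.

Lemma ripDl f g h : rip (f + g) h = rip f h + rip g h.
Proof. by rewrite /rip linearDl /=; case: (inner H f h); case: (inner H g h). Qed.

Lemma ripNl f h : rip (- f) h = - rip f h.
Proof. by rewrite /rip linearNl /=; case: (inner H f h). Qed.

Lemma ripZl (r : R) f h : rip (real_complex R r *: f) h = r * rip f h.
Proof.
rewrite /rip linearZl_LR /=; case: (inner H f h) => a b /=.
by rewrite mul0r subr0.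
Qed.

Lemma ripDr f g h : rip f (g + h) = rip f g + rip f h.
Proof. by rewrite ripC ripDl !(ripC _ f). Qed.

Lemma ripNr f h : rip f (- h) = - rip f h.
Proof. by rewrite ripC ripNl ripC. Qed.

Lemma ripZr (r : R) f h : rip f (real_complex R r *: h) = r * rip f h.
Proof. by rewrite ripC ripZl ripC. Qed.

Lemma inner_rip f : inner H f f = real_complex R (rip f f).
Proof. by rewrite /rip RRe_real // ger0_real // inner_norm exprn_ge0. Qed.

Lemma rip_ge0 f : 0 <= rip f f.
Proof. by rewrite -ler0c -inner_rip inner_norm exprn_ge0. Qed.

Lemma rip_eq0 f : rip f f = 0 -> f = 0.
Proof.
move=> f0; apply/eqP; rewrite -normr_eq0 -sqrf_eq0 -inner_norm inner_rip f0.
by rewrite eqxx.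
Qed.

Lemma rip_norm f : `|f| = real_complex R (Num.sqrt (rip f f)).
Proof.
apply/eqP; rewrite -(@eqrXn2 _ 2) // ?ler0c ?sqrtr_ge0 //.
by rewrite -inner_norm inner_rip -rmorphXn /= sqr_sqrtr ?rip_ge0.
Qed.

Lemma rip_cauchy_schwarz f g : rip f g ^+ 2 <= rip f f * rip g g.
Proof.
have [g0|g0] := eqVneq (rip g g) 0.
  have -> : rip f g = 0 by rewrite (rip_eq0 _ g0) -[0]subr0 ripDr ripNr subrr.
  by rewrite g0 mulr0 expr0n.
have gp : 0 < rip g g by rewrite lt_neqAle eq_sym g0 rip_ge0.
(* The square of this vector is <g,g> (<f,f> <g,g> - <f,g>^2), and <g,g> > 0. *)
have := rip_ge0 (real_complex R (rip g g) *: f - real_complex R (rip f g) *: g).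
rewrite !(ripDl, ripDr, ripNl, ripNr, ripZl, ripZr) (ripC g f) => h.
rewrite -subr_ge0 -(pmulr_rge0 _ gp); nra.
Qed.

Lemma rip_inj f g : (forall h, rip h f = rip h g) -> f = g.
Proof.
move=> fg; apply/eqP; rewrite -subr_eq0; apply/eqP/rip_eq0.
by rewrite ripDr ripNr fg subrr.
Qed.

Lemma rip_ball (y g : H) (r : R) : ball y (real_complex R r) g ->
  rip (y - g) (y - g) <= r ^+ 2.
Proof.
rewrite -ball_normE /ball_ /= rip_norm ltcR => h.
rewrite -[leLHS]sqr_sqrtr ?rip_ge0 // lerXn2r ?nnegrE ?sqrtr_ge0 ?(ltW h) //.
exact: le_trans (ltW h).
Qed.

(* Sums s of N of the vectors e k, chosen nearly orthogonal to one another,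
   satisfy |s|^2 <= 2 N whereas <y, s> >= N d. *)
Lemma nearly_orthonormal_weak_null (e : nat -> H) (y : H) (d : R) :
    (forall k, rip (e k) (e k) = 1) ->
    (forall j (r : R), 0 < r -> \forall k \near \oo, `|rip (e j) (e k)| <= r) ->
    0 < d -> (forall N, exists2 k, (N <= k)%N & d <= rip y (e k)) -> False.
Proof.
move=> e1 eo d0 ye.
have step N : exists s : H, [/\ rip s s <= 2 * N%:R, N%:R * d <= rip y s &
    forall r : R, 0 < r -> \forall k \near \oo, `|rip s (e k)| <= r].
  elim: N => [|N [s [s1 s2 s3]]].
    have z f : rip 0 f = 0 by rewrite -[0]subr0 ripDl ripNl subrr.
    exists 0; split; rewrite ?mulr0 ?mul0r ?z // ?(ripC y) ?z // => r r0.
    by apply: nearW => k; rewrite z normr0 ltW.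
  have [|M _ HM] := s3 (1 / 2); first by lra.
  have [k Mk yk] := ye M.
  have /ler_normlP[sk1 sk2] := HM _ Mk.
  exists (s + e k); split.
  - rewrite !(ripDl, ripDr) e1 (ripC (e k)) -natr1; lra.
  - rewrite ripDr -natr1; lra.
  move=> r r0; have r20 : 0 < r / 2 by rewrite divr_gt0.
  near=> l; rewrite ripDl (le_trans (ler_normD _ _)) // [leRHS]splitr.
  apply: lerD; near: l; [exact: s3|exact: eo].
(* For [N.+1] summands, Cauchy-Schwarz gives (N+1)^2 d^2 <= 2 (N+1) |y|^2, which fails once N+1 > 2
   |y|^2 / d^2. *)
have [N HN] : exists N, 2 * rip y y / d ^+ 2 < N.+1%:R.
  exists (Num.trunc (2 * rip y y / d ^+ 2)); exact: truncnS_gt.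
have [s [s1 s2 _]] := step N.+1.
have cs := rip_cauchy_schwarz y s.
move: HN s1 s2; rewrite ltr_pdivrMr ?exprn_gt0 //.
set M : R := N.+1%:R => HN s1 s2.
have M0 : 0 < M by rewrite ltr0n.
have h1 : (M * d) ^+ 2 <= rip y s ^+ 2.
  rewrite lerXn2r // ?nnegrE; last by apply: le_trans s2; rewrite mulr_ge0 ?ltW.
  by rewrite mulr_ge0 ?ltW.
have h2 : rip y y * rip s s <= rip y y * (2 * M) by rewrite ler_wpM2l ?rip_ge0.
have h3 : M * (M * d ^+ 2) <= M * (2 * rip y y).
  by have := le_trans h1 (le_trans cs h2); rewrite exprMn; lra.
by move: h3; rewrite ler_pM2l // leNgt HN.
Unshelve. all: by end_near.
Qed.

(** Compactness gives the vectors D (e k) a cluster point y. Whenever D (e k) is within d/2 of y,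
    <y, e k> >= d/2; this happens for arbitrarily large k, against the previous lemma. *)
Lemma nearly_orthonormal_not_compact (D : H -> H) (e : nat -> H) (d : R) :
    (forall k, rip (e k) (e k) = 1) ->
    (forall j (r : R), 0 < r -> \forall k \near \oo, `|rip (e j) (e k)| <= r) ->
    0 < d -> (forall k, d <= rip (D (e k)) (e k)) -> ~ compact_operator D.
Proof.
move=> e1 eo d0 De cD.
have [] := cD ((D \o e) @ \oo).
  apply: filterS (_ : \forall k \near \oo, True); last exact: nearW.
  move=> k _ /=; apply: subset_closure; exists (e k) => //=.
  by rewrite rip_norm e1 sqrtr1.
move=> y [_ cy].
apply: (@nearly_orthonormal_weak_null e y (d / 2)) => //; first by rewrite divr_gt0.
move=> N.
have d2 : 0 < real_complex R (d / 2) by rewrite ltcR divr_gt0.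
have := cy [set D (e k) | k in [set k | (N <= k)%N]] (ball y (real_complex R (d / 2))).
case; first by exists N => // k /= Nk; exists k.
  exact: nbhsx_ballx.
move=> _ [[k Nk <-] /rip_ball yk].
exists k => //.
have := rip_cauchy_schwarz (y - D (e k)) (e k).
rewrite e1 mulr1 => /le_trans/(_ yk) h.
have : - (d / 2) <= rip (y - D (e k)) (e k).
  by rewrite leNgt; apply/negP => hlt; nra.
have := De k; rewrite ripDl ripNl; lra.
Qed.

(** * Lower bound for the self-commutator *)

Section SelfCommutator.
Variables (T : {linear H -> H}) (S : H -> H).
Hypothesis adjTS : adjoint T S.

Lemma rip_adjoint f g : rip (T f) g = rip f (S g).
Proof. by rewrite /rip adjTS. Qed.

(** [S] is a bare function; its homogeneity comes from the adjoint relation. *)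
Lemma adjointZ (r : R) f : S (real_complex R r *: f) = real_complex R r *: S f.
Proof. by apply: rip_inj => h; rewrite -rip_adjoint !ripZr rip_adjoint. Qed.

Lemma rip_self_commutatorZ (r : R) f :
  let D f := S (T f) - T (S f) in
  rip (D (real_complex R r *: f)) (real_complex R r *: f) =
  r ^+ 2 * (rip (T f) (T f) - rip (S f) (S f)).
Proof.
rewrite /= linearZ !adjointZ linearZ -scalerBr ripZl ripZr mulrA ripDl ripNl.
by rewrite !rip_adjoint ripC -rip_adjoint.
Qed.

(* Cauchy-Schwarz for <T (v k true), v k true - v k false> bounds |T (v k true)|
   from below by a multiple of its adjoint counterpart that exceeds 1. *)
Lemma product_kernel_not_essentially_normal (v : nat -> bool -> H)
    (F : nat -> nat -> R) (a b y : R) :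
    (forall k l s t, rip (v k s) (v l t) = F k l * (if s == t then a else b)) ->
    (forall k s, S (v k s) = real_complex R (if s then y else - y) *: v k s) ->
    0 < a -> a <= 2 * b -> 0 < y -> (forall k, 0 < F k k) ->
    (forall l (r : R), 0 < r ->
      \forall k \near \oo, F l k ^+ 2 <= r * (F l l * F k k)) ->
  ~ compact_operator (fun f => S (T f) - T (S f)).
Proof.
move=> vF Sv a0 ab y0 F0 Fo.
(* Normalization: |v k true|^2 = F k k * a. *)
pose c k := (Num.sqrt (F k k * a))^-1.
have cE k : c k ^+ 2 * (F k k * a) = 1.
  by rewrite exprVn sqr_sqrtr ?mulVf ?mulr_ge0 ?ltW // gt_eqF // mulr_gt0.
apply: (@nearly_orthonormal_not_compact _ (fun k => real_complex R (c k) *: v k true)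
  (5 / 4 * y ^+ 2)).
- by move=> k; rewrite ripZl ripZr vF eqxx mulrA -expr2.
- move=> j r r0; apply: filterS (Fo j (r ^+ 2) (exprn_gt0 _ r0)) => k Fjk.
  rewrite ripZl ripZr vF eqxx -(@ler_pXn2r _ 2) ?nnegrE ?(ltW r0) //.
  rewrite -normrX ger0_norm ?sqr_ge0 //.
  have -> : (c j * (c k * (F j k * a))) ^+ 2 =
      (c j ^+ 2 * c k ^+ 2 * a ^+ 2) * F j k ^+ 2 by ring.
  have -> : r ^+ 2 = (c j ^+ 2 * c k ^+ 2 * a ^+ 2) * (r ^+ 2 * (F j j * F k k)).
    rewrite -[LHS]mulr1 -[in LHS](mulr1 1) -{1}(cE j) -(cE k); ring.
  by rewrite ler_wpM2l // -!exprMn sqr_ge0.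
- by have : 0 < y ^+ 2 by [rewrite exprn_gt0]; lra.
move=> k; rewrite rip_self_commutatorZ Sv ripZl ripZr vF eqxx.
have cs := rip_cauchy_schwarz (T (v k true)) (v k true - v k false).
move: cs; rewrite rip_adjoint.
set X := rip (T _) (T _) => cs.
have X0 : 0 <= X by exact: rip_ge0.
have Fk := F0 k.
(* The eigenvalues y and -y turn the difference into a sum: S (v k true - v k false) = y (v k true +
   v k false). *)
have e1 : rip (v k true) (S (v k true - v k false)) = y * F k k * (a + b).
  rewrite -rip_adjoint ripDr ripNr !rip_adjoint !Sv !ripZr !vF /=; ring.
have e2 : rip (v k true - v k false) (v k true - v k false) = 2 * F k k * (a - b).
  rewrite !(ripDl, ripDr, ripNl, ripNr) !vF /=; ring.
(* From a <= 2 b follow 2 (a - b) <= a and a + b >= 3/2 a, whence 9/4. Subtracting |S (v k true)|^2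
   = y^2 F k k a leaves the factor 5/4. *)
have X1 : 9 / 4 * y ^+ 2 * (F k k * a) <= X.
  move: cs; rewrite e1 e2 => cs.
  have h1 : X * (2 * F k k * (a - b)) <= X * (F k k * a).
    by rewrite ler_wpM2l //; nra.
  have h2 : (y * F k k) ^+ 2 * (9 / 4 * a ^+ 2) <= (y * F k k * (a + b)) ^+ 2.
    by rewrite [leRHS]exprMn ler_wpM2l ?sqr_ge0 //; nra.
  have Fa0 : 0 < F k k * a by rewrite mulr_gt0.
  by rewrite -(ler_pM2r Fa0); apply: le_trans h1; apply: le_trans cs; lra.
have c2 : 0 <= c k ^+ 2 by exact: sqr_ge0.
have := ler_wpM2l c2 X1; have := cE k; nra.
Qed.

End SelfCommutator.
End RealInner.

(** By the reproducing property, <h, S k> = <T h, k> = g(w) h(w) = <h, conj(g(w)) k> for every h. *)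
Lemma adjoint_mul_kernel (R : realType) (X : Type) (K : X -> X -> R[i])
    (H : rkhs K) (g : X -> R[i]) (T S : H -> H) (w : X) (k : H) :
    (forall f z, rkhs_fun H (T f) z = g z * rkhs_fun H f z) -> adjoint T S ->
    (forall f, rkhs_fun H f w = inner H f k) ->
  S k = Num.conj (g w) *: k.
Proof.
move=> Tg TS kw; apply: rip_inj => h; congr (complex.Re _).
by rewrite -TS -kw Tg kw linearZr_LR /= conjCK.
Qed.

(** * Multivariate polynomials with nonnegative coefficients *)

(** The coefficient of the derivative at s - U_(i) is s_i times that of p at s, and the
    characteristic is 0. *)
Lemma mcoeff_mderiv_eq0 (R : numDomainType) (n : nat) (p : {mpoly R[n]})
    (i : 'I_n) (s : 'X_{1..n}) : p^`M(i) = 0 -> s i != 0%N -> p@_s = 0.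
Proof.
move=> pi si; have /eqP := mcoeff_mderiv i p (s - U_(i)).
rewrite pi mcoeff0 submK ?lep1mP // eq_sym mulrn_eq0 /=.
by move/eqP.
Qed.

Lemma eq_meval_coeff (R : comNzRingType) (n : nat) (p : {mpoly R[n]})
    (i : 'I_n) (f g : 'I_n -> R) :
    (forall s : 'X_{1..n}, s i != 0%N -> p@_s = 0) ->
    (forall j, j != i -> f j = g j) -> p.@[f] = p.@[g].
Proof.
move=> pi fg; rewrite !mevalE; apply: eq_bigr => s _.
have [si|/pi->] := eqVneq (s i) 0%N; last by rewrite !mul0r.
congr (_ * _); apply: eq_bigr => j _.
by have [->|/fg->//] := eqVneq j i; rewrite si !expr0.
Qed.

(** Turns p along a polynomial curve into a univariate polynomial, to which the intermediate value
    theorem applies. *)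
Lemma horner_mmap_polyC (R : comNzRingType) (n : nat) (p : {mpoly R[n]})
    (h : 'I_n -> {poly R}) (x : R) :
  (mmap polyC h p).[x] = p.@[fun j => (h j).[x]].
Proof.
rewrite /mmap horner_sum mevalE; apply: eq_bigr => s _.
rewrite hornerM hornerC /mmap1 horner_prod; congr (_ * _).
by apply: eq_bigr => j _; rewrite horner_exp.
Qed.

Lemma meval_map_mpoly (R S : comNzRingType) (f : {rmorphism R -> S}) (n : nat)
    (p : {mpoly R[n]}) (h : 'I_n -> R) :
  (map_mpoly f p).@[fun j => f (h j)] = f (p.@[h]).
Proof.
rewrite [in LHS](mpolyE p) (raddf_sum (map_mpoly f)) (raddf_sum (meval _)).
rewrite mevalE raddf_sum /=.
apply: eq_bigr => s _.
rewrite map_mpolyZ map_mpolyX mevalZ mevalX rmorphM rmorph_prod; congr (_ * _).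
by apply: eq_bigr => j _; rewrite rmorphXn.
Qed.

Lemma map_mpoly_surj (R S : comNzRingType) (f : {rmorphism R -> S}) (g : S -> R)
    (n : nat) (q : {mpoly S[n]}) :
  (forall s, f (g q@_s) = q@_s) -> exists p, q = map_mpoly f p.
Proof.
move=> fg; exists (\sum_(s <- msupp q) g q@_s *: 'X_[s]).
rewrite [LHS]mpolyE (raddf_sum (map_mpoly f)); apply: eq_bigr => s _.
by rewrite /= map_mpolyZ map_mpolyX fg.
Qed.

(** In the order of [R[i]] a nonnegative coefficient is real, so p consists of the real parts. *)
Lemma real_mpoly (R : realType) (n : nat) (q : {mpoly R[i][n]}) :
    (forall s, 0 <= q@_s) ->
  exists2 p : {mpoly R[n]}, forall s, q@_s = real_complex R p@_s &
    forall f, q.@[fun j => real_complex R (f j)] = real_complex R p.@[f].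
Proof.
move=> q0.
have [s|p ->] := @map_mpoly_surj _ _ (real_complex R) (@complex.Re R) _ q.
  by apply: RRe_real; apply: ger0_real.
by exists p => [s|f]; rewrite ?mcoeff_map_mpoly ?meval_map_mpoly.
Qed.

Section NonnegCoefficients.
Context {R : realFieldType} {n : nat}.
Variable p : {mpoly R[n]}.
Hypothesis p0 : forall s, 0 <= p@_s.
Implicit Types f g : 'I_n -> R.

Lemma ler_norm_meval f g : (forall j, `|f j| <= g j) -> `|p.@[f]| <= p.@[g].
Proof.
move=> fg; rewrite !mevalE (le_trans (ler_norm_sum _ _ _)) //.
apply: ler_sum => s _; rewrite normrM ger0_norm // ler_wpM2l // normr_prod.
apply: ler_prod => j _; rewrite normr_ge0 normrX /=.
by rewrite lerXn2r ?nnegrE // (le_trans _ (fg j)).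
Qed.

Lemma meval_nonneg f : (forall j, 0 <= f j) -> 0 <= p.@[f].
Proof.
move=> f0; rewrite mevalE; apply: sumr_ge0 => s _.
by rewrite mulr_ge0 // prodr_ge0 // => j _; rewrite exprn_ge0.
Qed.

Lemma ler_coeffU_meval i f : (forall j, 0 <= f j) -> p@_U_(i) * f i <= p.@[f].
Proof.
move=> f0; have [/memN_msupp_eq0->|pi] := boolP (U_(i)%MM \notin msupp p).
  by rewrite mul0r meval_nonneg.
rewrite negbK in pi; rewrite mevalE (bigD1_seq _ pi) ?msupp_uniq //=.
rewrite (bigD1 i) //= mnmE eqxx expr1 [X in _ * (_ * X)]big1 => [|j ji].
  rewrite mulr1 lerDl; apply: sumr_ge0 => s _.
  by rewrite mulr_ge0 // prodr_ge0 // => j _; rewrite exprn_ge0.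
by rewrite mnmE eq_sym (negbTE ji) expr0.
Qed.

(** Monomial by monomial, this is ab <= (a^2 + b^2) / 2. *)
Lemma meval_prod_le_mean f g :
  p.@[fun j => f j * g j] <=
  (p.@[fun j => f j ^+ 2] + p.@[fun j => g j ^+ 2]) / 2.
Proof.
rewrite !mevalE -big_split mulr_suml /=; apply: ler_sum => s _.
rewrite -mulrDr -mulrA ler_wpM2l //.
under eq_bigr do rewrite exprMn.
under [in leRHS]eq_bigr do rewrite exprAC.
under [X in _ <= (_ + X) / _]eq_bigr do rewrite exprAC.
rewrite big_split /= !prodrXl.
set a := \prod_i _; set b := \prod_i _.
have := sqr_ge0 (a - b); rewrite sqrrB; lra.
Qed.

(** Every monomial present has degree d >= 1, and c^d <= c. *)
Lemma meval_scale_le (c : R) : p@_0 = 0 -> 0 <= c <= 1 ->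
  p.@[fun=> c] <= c * p.@[fun=> 1].
Proof.
move=> p00 /andP[c0 c1]; rewrite !mevalE mulr_sumr; apply: ler_sum => s _.
rewrite mulrCA; have [->|s0] := eqVneq s 0%MM; first by rewrite p00 !mul0r.
rewrite ler_wpM2l // [X in _ <= c * X]big1 ?mulr1 => [|j _]; last exact: expr1n.
rewrite prodrXr /= -[leRHS]expr1 ler_wiXn2l //.
by rewrite -mdegE lt0n mdeg_eq0.
Qed.

End NonnegCoefficients.

(** * The kernel at real points *)

(** The sum of the [Q k] starts at degree 2, so it contributes nothing in degrees 0 and 1. *)
Lemma positive_regular_coeff (R : realType) (n : nat)
    (P : 'I_n.+1 -> {mpoly R[i][n.+1]}) (j : 'I_n.+1) :
  positive_regular P ->
  [/\ forall s, 0 <= (P j)@_s, (P j)@_0 = 0 & 0 < (P j)@_U_(j)].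
Proof.
move=> /(_ j)[P0 [a [N [Q [a0 Qh Pj]]]]]; split=> //; rewrite Pj.
  rewrite mcoeffD mcoeffZ mcoeffX mnm1_eq0 mulr0 add0r raddf_sum /= big_nat_cond.
  rewrite big1 // => k /andP[/andP[k2 _] _].
  by rewrite (dhomog_nemf_coeff (Qh k)) //= mdeg0 eq_sym -lt0n (ltn_trans _ k2).
rewrite mcoeffD mcoeffZ mcoeffX eqxx mulr1 raddf_sum /= big_nat_cond.
rewrite big1 ?addr0 // => k /andP[/andP[k2 _] _].
by rewrite (dhomog_nemf_coeff (Qh k)) //= mdeg1 neq_ltn k2.
Qed.

Section RealPoints.
Context {R : realType} {n : nat}.
Implicit Types u v : 'I_n.+1 -> R.

(** Inverts [phi]: z_j = u_j ... u_n has z_j / z_{j+1} = u_j and z_n = u_n. *)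
Definition tail_prod u (j : 'I_n.+1) : R := \prod_(l < n.+1 | (j <= l)%N) u l.

Definition real_point u : 'rV[R[i]]_n.+1 := \row_j real_complex R (tail_prod u j).

(** The product of z_2, ..., z_n, which makes up the kernel prefactor. *)
Definition denom u : R := \prod_(j < n.+1 | j != ord0) tail_prod u j.

Lemma tail_prod_neq0 u j : (forall l, u l != 0) -> tail_prod u j != 0.
Proof. by move=> u0; apply/prodf_neq0. Qed.

Lemma denom_neq0 u : (forall l, u l != 0) -> denom u != 0.
Proof. by move=> u0; apply/prodf_neq0 => j _; exact: tail_prod_neq0. Qed.

Lemma tail_prod_max u : tail_prod u ord_max = u ord_max.
Proof.
rewrite /tail_prod (big_pred1 ord_max) // => l.
by rewrite /= -val_eqE /= eqn_leq leq_ord.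
Qed.

Lemma phi_real_point u : (forall l, u l != 0) ->
  phi (real_point u) = \row_j real_complex R (u j).
Proof.
move=> u0; apply/rowP => j; rewrite !mxE; case: ltnP => jn; last first.
  have -> : j = ord_max by apply/val_inj/eqP; rewrite /= eqn_leq leq_ord jn.
  by rewrite tail_prod_max.
rewrite -fmorphV -rmorphM; congr (real_complex R _).
rewrite {1}/tail_prod (bigD1 j) //= [X in _ * X / _](_ : _ = tail_prod u (inord j.+1)).
  by rewrite mulfK // tail_prod_neq0.
apply: eq_bigl => l; rewrite inordK //.
by rewrite ltn_neqAle andbC; congr (_ && _); rewrite eq_sym.
Qed.

Variables (P : 'I_n.+1 -> {mpoly R[i][n.+1]}) (p : 'I_n.+1 -> {mpoly R[n.+1]}).
Hypothesis Pp : forall j f,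
  (P j).@[fun l => real_complex R (f l)] = real_complex R (p j).@[f].

Lemma Peval_real_point j u v : (forall l, u l != 0) -> (forall l, v l != 0) ->
  Peval P j (real_point u) (real_point v) =
  real_complex R (p j).@[fun l => u l * v l].
Proof.
move=> u0 v0; rewrite -Pp /Peval !phi_real_point //; apply: meval_eq => l.
by rewrite !mxE rmorphM; congr (_ * _); exact: conjc_real.
Qed.

Lemma triangle_real_point u : (forall l, u l != 0) ->
  (forall j, (p j).@[fun l => u l * u l] < 1) -> triangle P (real_point u).
Proof.
move=> u0 u1; split=> j.
  by move=> _; rewrite mxE fmorph_eq0 tail_prod_neq0.
by rewrite Peval_real_point // (ltcR _ 1).
Qed.

Lemma kernel_real_point (m : 'I_n.+1 -> nat) u v :
    (forall l, u l != 0) -> (forall l, v l != 0) ->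
  Defs.kernel P m (real_point u) (real_point v) =
  real_complex R ((denom u * denom v)^-1 *
    \prod_j ((1 - (p j).@[fun l => u l * v l]) ^+ m j)^-1).
Proof.
move=> u0 v0; rewrite /Defs.kernel rmorphM fmorphV rmorph_prod; congr (_ * _).
  rewrite /denom -big_split rmorph_prod -prodfV /=; apply: eq_bigr => j _.
  by rewrite !mxE rmorphM /=; congr (_ * _)^-1; exact: conjc_real.
apply: eq_bigr => j _; rewrite Peval_real_point //.
by rewrite fmorphV rmorphXn rmorphB rmorph1.
Qed.

End RealPoints.

(** * Choice of the points *)

Lemma bernoulli_ineq (R : realFieldType) (e : R) N :
  0 <= e <= 1 -> 1 - N%:R * e <= (1 - e) ^+ N.
Proof.
move=> /andP[e0 e1]; elim: N => [|N IH]; first by rewrite mul0r subr0.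
rewrite exprS -natr1; have N0 : 0 <= N%:R :> R by [].
have : (1 - e) * (1 - N%:R * e) <= (1 - e) * (1 - e) ^+ N.
  by rewrite ler_wpM2l // subr_ge0.
have : 0 <= N%:R * e * e by rewrite !mulr_ge0.
lra.
Qed.

(** With N the sum of the exponents, it suffices that (1 + e)^N <= 2 (1 - e)^N. Bernoulli gives (1 -
    e)^N >= 3/4, and (1 - e^2)^N <= 1 then gives (1 + e)^N <= 4/3. *)
Lemma prod_inv_expr_ratio (R : realFieldType) (I : finType) (Q : pred I)
    (m : I -> nat) (r s : I -> R) (e : R) :
    0 < e -> 4 * (\sum_(j | Q j) m j)%:R * e <= 1 -> e < 1 ->
    (forall j, Q j -> r j <= e) -> (forall j, Q j -> - e <= s j <= e) ->
  \prod_(j | Q j) ((1 - r j) ^+ m j)^-1 <=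
  2 * \prod_(j | Q j) ((1 - s j) ^+ m j)^-1.
Proof.
move=> e0; set N := (\sum_(j | Q j) m j)%N => Ne e1 re se.
have me : 0 < 1 - e by rewrite subr_gt0.
have pe : 0 < 1 + e by rewrite addr_gt0.
have h1 : \prod_(j | Q j) ((1 - r j) ^+ m j)^-1 <= ((1 - e) ^+ N)^-1.
  rewrite /N -prodrXr -prodfV; apply: ler_prod => j Qj.
  have rj : 1 - e <= 1 - r j by rewrite lerB // re.
  have rj0 := lt_le_trans me rj.
  by rewrite invr_ge0 exprn_ge0 ?(ltW rj0) // lef_pV2 ?posrE ?exprn_gt0 //
     lerXn2r // nnegrE ltW.
have h2 : ((1 + e) ^+ N)^-1 <= \prod_(j | Q j) ((1 - s j) ^+ m j)^-1.
  rewrite /N -prodrXr -prodfV; apply: ler_prod => j Qj.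
  have /andP[s1 s2] := se j Qj.
  have sj : 1 - s j <= 1 + e by lra.
  have sj0 : 0 < 1 - s j by lra.
  by rewrite invr_ge0 exprn_ge0 ?(ltW pe) // lef_pV2 ?posrE ?exprn_gt0 //
     lerXn2r // nnegrE ltW.
apply: (le_trans h1); apply: (@le_trans _ _ (2 * ((1 + e) ^+ N)^-1)); last first.
  by rewrite ler_pM2l.
have := @bernoulli_ineq R e N; rewrite (ltW e0) (ltW e1) => /(_ isT) hB.
have h3 : (1 - e) ^+ N * (1 + e) ^+ N <= 1.
  by rewrite -exprMn exprn_ile1 ?mulr_ge0 ?ltW //; nra.
have pN : 0 < (1 + e) ^+ N by rewrite exprn_gt0.
have mN : 0 < (1 - e) ^+ N by rewrite exprn_gt0.
rewrite ler_pdivlMr // mulrC ler_pdivrMr //.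
set a := (1 - e) ^+ N in hB h3 mN *; set b := (1 + e) ^+ N in h3 pN *.
have : 3 / 4 <= a by lra.
nra.
Qed.

(** Intermediate values of x -> q x x. Denominators starting at 2 keep the target strictly above q 0
    0, so the root found is not 0. *)
Lemma points_to_boundary (R : realType) (n : nat) (p : {mpoly R[n]})
    (i : 'I_n) (u : 'I_n -> R) :
    (forall s, 0 <= p@_s) -> 0 < p@_U_(i) -> (forall j, 0 <= u j) ->
    let q (x y : R) := p.@[fun j => if j == i then x * y else u j ^+ 2] in
    q 0 0 < 1 ->
  exists x : nat -> R, forall k,
    0 < x k /\ q (x k) (x k) = 1 - (1 - q 0 0) / k.+2%:R.
Proof.
move=> p0 pi u0 q q1; suff h k : exists x : R,
    0 < x /\ q x x = 1 - (1 - q 0 0) / k.+2%:R.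
  by have [x hx] := boolp.choice h; exists x.
pose f : {poly R} := mmap polyC (fun j => if j == i then 'X ^+ 2 else (u j ^+ 2)%:P) p.
have fE x : f.[x] = q x x.
  rewrite horner_mmap_polyC; apply: meval_eq => j.
  by case: ifP => _; rewrite ?hornerXn ?hornerC // expr2.
pose y := 1 - (1 - q 0 0) / k.+2%:R.
have d0 : 0 < (1 - q 0 0) / k.+2%:R by rewrite divr_gt0 ?subr_gt0.
have d1 : (1 - q 0 0) / k.+2%:R < 1 - q 0 0.
  by rewrite ltr_pdivrMr // ltr_pMr ?subr_gt0 // ltr1n.
(* At this b the linear term alone reaches 1: p_i b^2 >= p_i b = p_i + 1, where p_i is the
   coefficient of the i-th variable. *)
pose b := 1 + (p@_U_(i))^-1.
have b1 : 1 <= b by rewrite lerDl invr_ge0 ltW.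
have qb : 1 <= q b b.
  apply: le_trans (ler_coeffU_meval p p0 i _ _); last first.
    by move=> j /=; case: ifP => _; rewrite ?mulr_ge0 ?exprn_ge0 // (le_trans _ b1).
  rewrite eqxx; apply: (@le_trans _ _ (p@_U_(i) * b)).
    by rewrite mulrDr mulr1 divff ?gt_eqF // lerDr ltW.
  by rewrite ler_pM2l // ler_peMl // (le_trans _ b1).
have [|x /andP[x0 xb]] := @poly_ivt R (f - y%:P) 0 b (le_trans ler01 b1).
  rewrite !hornerE !fE /y.
  move: (q 0 0) (_ / _) (q b b) d0 d1 qb => q0 t qb' t0 t1 qb1.
  by apply/andP; split; lra.
rewrite rootE !hornerE fE subr_eq0 => /eqP qx; exists x; split => //.
rewrite lt_neqAle x0 andbT; apply/eqP => x00; move: qx; rewrite -x00 /y.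
by move: (q 0 0) (_ / _) d1 => q0 t t1 qt; lra.
Qed.

(** For fixed l, A l k >= A l l / 2 bounds F l k uniformly in k, while F l l >= 1 and F k k >= k + 2
    tends to infinity. *)
Lemma near_boundary_ratio (R : realType) (A : nat -> nat -> R) (d : R) (M : nat) :
    0 < d <= 1 -> (0 < M)%N -> (forall k, A k k = d / k.+2%:R) ->
    (forall l k, A l l <= 2 * A l k) ->
  let F l k := (A l k ^+ M)^-1 in
  forall l (r : R), 0 < r ->
    (\forall k \near \oo%classic, F l k ^+ 2 <= r * (F l l * F k k))%classic.
Proof.
move=> /andP[d0 d1] M0 AE Ah F l r r0.
have A0 k : 0 < A k k by rewrite AE divr_gt0.
have A1 k : A k k <= 1.
  by rewrite AE ler_pdivrMr // mul1r (le_trans d1) // ler1n.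
have F1 k : (A k k)^-1 <= F k k.
  rewrite lef_pV2 ?posrE ?exprn_gt0 //.
  by rewrite -[leRHS]expr1 ler_wiXn2l ?(ltW (A0 _)).
pose C := ((A l l / 2) ^+ M)^-1.
have FC k : 0 <= F l k <= C.
  have h : A l l / 2 <= A l k by have := Ah l k; lra.
  have h0 : 0 < A l l / 2 by rewrite divr_gt0.
  have h1 := lt_le_trans h0 h.
  by rewrite invr_ge0 exprn_ge0 ?(ltW h1) //= lef_pV2 ?posrE ?exprn_gt0 //
    lerXn2r // nnegrE ltW.
exists (Num.trunc (C ^+ 2 / r)) => // k /= kC.
have kr : C ^+ 2 <= r * k.+2%:R.
  rewrite mulrC -ler_pdivrMr //; apply: ltW.
  apply: lt_le_trans (truncnS_gt _) _; rewrite ler_nat.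
  by rewrite ltnS (leq_trans kC).
have /andP[f0 fC] := FC k.
apply: (@le_trans _ _ (C ^+ 2)); first by rewrite lerXn2r ?nnegrE // (le_trans f0).
apply: (le_trans kr); rewrite ler_pM2l //.
have Fl1 : 1 <= F l l.
  by apply: le_trans (F1 l); rewrite -invr1 lef_pV2 ?posrE.
have Fk : k.+2%:R <= F k k.
  apply: le_trans (F1 k); rewrite AE invf_div ler_pdivlMr //.
  by rewrite ler_piMr.
by apply: (le_trans Fk); rewrite ler_peMl // (le_trans _ Fk).
Qed.

(** * Test vectors at real points and conclusion *)

Theorem proposition5p2 (R : realType) (n : nat) (hn : (2 <= n.+1)%N)
    (m : 'I_n.+1 -> nat) (hm : forall j, (0 < m j)%N)
    (P : 'I_n.+1 -> {mpoly R[i][n.+1]}) (hP : positive_regular P)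
    (hPi : exists i : 'I_n.+1,
      [/\ (i < n)%N,
          (P i)^`M(ord_max) = 0
        & forall j : 'I_n.+1, j != i -> (P j)^`M(i) = 0])
    (H : H2 P m) (Mzn : {linear H -> H})
    (bMzn : bounded_operator Mzn) (hMzn : is_mulz ord_max Mzn) :
  ~ essentially_normal Mzn.
Proof.
move=> [S adjS cD]; case: hPi => i [hin Pi0 Pj0].
have im : i != ord_max by rewrite -val_eqE /= neq_ltn hin.
have hp j : exists p : {mpoly R[n.+1]},
    (forall s, (P j)@_s = real_complex R p@_s) /\
    (forall f, (P j).@[fun l => real_complex R (f l)] = real_complex R p.@[f]).
  have [P0 _ _] := @positive_regular_coeff _ _ _ j hP.
  by have [p ? ?] := real_mpoly _ _ _ P0; exists p.
have [p pP] := boolp.choice hp.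
have pE j : forall f, (P j).@[fun l => real_complex R (f l)] = real_complex R (p j).@[f].
  by case: (pP j).
have p0 j s : 0 <= (p j)@_s.
  rewrite -ler0c -(pP j).1.
  by have [P0 _ _] := @positive_regular_coeff _ _ _ j hP.
have p00 j : (p j)@_0 = 0.
  have [_ P0 _] := @positive_regular_coeff _ _ _ j hP.
  by apply: complexI; rewrite -(pP j).1 P0.
have pU : 0 < (p i)@_U_(i).
  have [_ _ P1] := @positive_regular_coeff _ _ _ i hP.
  by rewrite -(ltcR 0) -(pP i).1.
have pi0 (s : 'X_{1..n.+1}) : s ord_max != 0%N -> (p i)@_s = 0.
  move=> s0; apply: complexI; rewrite -(pP i).1.
  exact: mcoeff_mderiv_eq0 Pi0 s0.
have pj0 j (s : 'X_{1..n.+1}) : j != i -> s i != 0%N -> (p j)@_s = 0.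
  move=> ji s0; apply: complexI; rewrite -(pP j).1.
  exact: mcoeff_mderiv_eq0 (Pj0 j ji) s0.
(* The total exponent of the factors other than the i-th; the successor in [e] yields both 4 M e <=
   1 and e < 1. *)
pose M := (\sum_(j | j != i) m j)%N.
pose e : R := (4 * M.+1%:R)^-1.
have M1 : 1 <= M.+1%:R :> R by rewrite ler1n.
have e0 : 0 < e by rewrite invr_gt0 mulr_gt0.
have eM : e * (4 * M.+1%:R) = 1 by rewrite mulVf // gt_eqF // mulr_gt0.
have e1 : e < 1 by nra.
have Me : 4 * M%:R * e <= 1 by move: eM; rewrite -natr1; nra.
pose s1 := \sum_j (p j).@[fun=> 1].
have p1 j : 0 <= (p j).@[fun=> 1] by exact: meval_nonneg.
have s10 : 0 <= s1 by exact: sumr_ge0.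
(* Makes every p j at most e at (c^2, ..., c^2): p j has no constant term, so its value is at most
   c^2 s1 <= c s1 <= e. *)
pose c := e / (1 + s1).
have c0 : 0 < c by rewrite divr_gt0 // ltr_pwDl.
have cs : c * (1 + s1) = e by rewrite divfK // gt_eqF // ltr_pwDl.
have c1 : c <= 1 by nra.
have cc1 : 0 <= c * c <= 1 by rewrite mulr_ge0 ?(ltW c0) //=; nra.
have pc j : (p j).@[fun=> c * c] <= e.
  apply: (le_trans (meval_scale_le _ (p0 j) _ (p00 j) cc1)).
  have : (p j).@[fun=> 1] <= s1.
    by rewrite /s1 (bigD1 j) //= lerDl sumr_ge0.
  have := p1 j; nra.
(* In [q] the entry at [ord_max], and in [r] the entry at [i], is a default: p i does not involve
   u_n and the other p j do not involve u_i. *)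
pose q (x y : R) := (p i).@[fun j => if j == i then x * y else c ^+ 2].
pose r (t : R) j := (p j).@[fun l => if l == ord_max then t else c * c].
have rle (t : R) j : `|t| <= c * c -> `|r t j| <= e.
  move=> tc; apply: le_trans (pc j); apply: (ler_norm_meval _ (p0 j)) => l.
  by case: ifP => _ //; rewrite ger0_norm //; case/andP: cc1.
have q0 : 0 <= q 0 0.
  by apply: (meval_nonneg _ (p0 i)) => l; case: ifP => _; rewrite ?mulr0 ?sqr_ge0.
have q1 : q 0 0 < 1.
  apply: le_lt_trans e1; apply: le_trans (pc i).
  apply: le_trans (ler_norm _) _; apply: (ler_norm_meval _ (p0 i)) => l.
  case: ifP => _; last by rewrite ger0_norm ?sqr_ge0.
  by rewrite mulr0 normr0; case/andP: cc1.
have [x xq] : exists x : nat -> R, forall k,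
    0 < x k /\ q (x k) (x k) = 1 - (1 - q 0 0) / k.+2%:R.
  exact: (points_to_boundary _ _ (p i) i (fun=> c) (p0 i) pU (fun=> ltW c0)).
pose sg (s : bool) : R := if s then c else - c.
pose u k s : 'I_n.+1 -> R :=
  fun j => if j == i then x k else if j == ord_max then sg s else c.
have u0 k s l : u k s l != 0.
  rewrite /u; case: ifP => _; first by rewrite gt_eqF // (xq k).1.
  case: ifP => _; last by rewrite gt_eqF.
  by case: s => /=; rewrite ?oppr_eq0 gt_eqF.
(* The separation of variables: the i-th polynomial sees only k and l, the others only whether the
   signs s and t agree. *)
have pu j k s l t : (p j).@[fun a => u k s a * u l t a] =
    if j == i then q (x k) (x l) else r (if s == t then c * c else - (c * c)) j.
  have [->|ji] := eqVneq j i.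
    apply: (eq_meval_coeff _ _ _ ord_max _ _ pi0) => a am.
    by rewrite /u (negbTE am) expr2; case: ifP.
  apply: (eq_meval_coeff _ _ _ i _ _ (fun s => pj0 j s ji)) => a ai.
  rewrite /u (negbTE ai) /sg; case: ifP => // _.
  by case: s t => [] [] /=; rewrite ?mulrNN ?mulrN ?mulNr.
have utri k s : triangle P (real_point (u k s)).
  apply: (triangle_real_point P p pE) => // j; rewrite pu eqxx.
  case: ifP => _; last first.
    apply: le_lt_trans (ler_norm _) _; apply: le_lt_trans e1; apply: rle.
    by rewrite ger0_norm //; case/andP: cc1.
  by rewrite (xq k).2 ltrBlDr ltrDl divr_gt0 // subr_gt0.
pose w k s : triangle P := SigSub (mem_set (utri k s)).
have [kf kfE] := boolp.choice (fun z : triangle P =>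
  let: ex_intro2 k kE kf := rkhs_reproducing H z in ex_intro _ k (conj kE kf)).
(* The factor [denom] cancels the prefactor of the kernel. *)
pose v k s : H := real_complex R (denom (u k s)) *: kf (w k s).
pose A l k := 1 - q (x l) (x k).
pose F l k := (A l k ^+ m i)^-1.
pose a := \prod_(j | j != i) ((1 - r (c * c) j) ^+ m j)^-1.
pose b := \prod_(j | j != i) ((1 - r (- (c * c)) j) ^+ m j)^-1.
have AE k : A k k = (1 - q 0 0) / k.+2%:R by rewrite /A (xq k).2 opprB addrC subrK.
have A0 k : 0 < A k k by rewrite AE divr_gt0 // subr_gt0.
(* The mean inequality gives 2 A l k >= A l l + A k k. *)
have AA l k : A l l <= 2 * A l k.
  have h : q (x l) (x k) <= (q (x l) (x l) + q (x k) (x k)) / 2.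
    have := meval_prod_le_mean _ (p0 i) (fun j => if j == i then x l else c)
      (fun j => if j == i then x k else c).
    rewrite /q; congr (_ <= (_ + _) / _); apply: meval_eq => j; case: ifP => _ //;
      by rewrite ?expr2.
  have := A0 k; rewrite /A; lra.
have Apos l k : A l k != 0.
  by apply: lt0r_neq0; have := AA l k; have := A0 l; lra.
apply: (@product_kernel_not_essentially_normal _ _ Mzn S adjS v F a b c) => //.
- move=> k l s t; rewrite ripZl ripZr /rip.
  rewrite -(kfE (w l t)).2 (kfE (w k s)).1 /= (kernel_real_point P p pE) //=.
  rewrite (bigD1 i) //= pu eqxx.
  under eq_bigr => j ji do rewrite pu (negbTE ji).
  have d1 := denom_neq0 (u k s) (u0 k s).
  have d2 := denom_neq0 (u l t) (u0 l t).
  (* Pairing with the second vector evaluates the first at the point of the second, so l and k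
     arrive swapped. *)
  rewrite (_ : q (x l) (x k) = q (x k) (x l)); last first.
    by apply: meval_eq => j; rewrite mulrC.
  rewrite /F /A /a /b (eq_sym t s); case: (s == t); field;
    by rewrite d1 d2 expf_neq0 //; exact: Apos.
- move=> k s; rewrite /v (adjointZ _ _ adjS).
  rewrite (adjoint_mul_kernel _ _ _ _ _ _ _ (w k s) _ hMzn adjS (kfE _).2).
  rewrite !scalerA mulrC /= mxE tail_prod_max /u eq_sym (negbTE im) eqxx.
  by congr (_ * _ *: _); exact: conjc_real.
- apply: prodr_gt0 => j _; rewrite invr_gt0 exprn_gt0 // subr_gt0.
  apply: le_lt_trans (ler_norm _) _; apply: le_lt_trans e1; apply: rle.
  by rewrite ger0_norm //; case/andP: cc1.
- apply: (prod_inv_expr_ratio _ _ _ _ _ _ e) => // j _.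
    apply: le_trans (ler_norm _) _; apply: rle.
    by rewrite ger0_norm //; case/andP: cc1.
  rewrite -ler_norml; apply: rle.
  by rewrite normrN ger0_norm //; case/andP: cc1.
- by move=> k; rewrite invr_gt0 exprn_gt0.
apply: (near_boundary_ratio _ A (1 - q 0 0) (m i)) => //.
  by rewrite subr_gt0 q1 lerBlDl lerDr.
Qed.
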